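(* Let $0 < p < 1$ and put $$\alpha = \frac{p^3 (2 + p)}{1 + 2p}, \qquad \beta = \frac{27}{4}\, \frac{p^2 (1+p)^2}{(1 + p + p^2)^3}.$$ Then $$(1 + p + p^2)\, F_2(1 - \alpha) = \sqrt{3 + 6p}\; F_3(1 - \beta).$$
   Context: $F(a,b;c;x) = {}_2F_1(a,b;c;x) = \sum_{n\ge 0} \frac{(a)_n (b)_n}{(c)_n\, n!} x^n$ is the Gauss hypergeometric function, where $(a)_n = a(a+1)\cdots(a+n-1)$. Abbreviations: $F_2(x) = F(\tfrac12, \tfrac12; 1; x)$ and $F_3(x) = F(\tfrac13, \tfrac23; 1; x)$. *)

(* Defs.v *)
(* Stdlib reals with Coquelicot. *)
From Stdlib Require Import Reals Factorial.
From Coquelicot Require Import Coquelicot.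
Open Scope R_scope.

(* (a)_n = a (a + 1) ... (a + n - 1) *)
Fixpoint pochhammer (a : R) (n : nat) : R :=
  match n with
  | O => 1
  | S m => pochhammer a m * (a + INR m)
  end.

Definition hyp2F1_coeff (a b c : R) (n : nat) : R :=
  pochhammer a n * pochhammer b n / (pochhammer c n * INR (fact n)).

(* The value is meaningful only where the power series converges (in
   particular for |x| < 1) and c is not a non-positive integer, since both
   [PSeries] and division are total. *)
Definition hyp2F1 (a b c x : R) : R := PSeries (hyp2F1_coeff a b c) x.

Definition F2 (x : R) : R := hyp2F1 (1 / 2) (1 / 2) 1 x.

Definition F3 (x : R) : R := hyp2F1 (1 / 3) (2 / 3) 1 x.

(* Main.v *)
(* Both sides, as functions of p, solve the same second-order linear equation,
   which has a regular singular point with double exponent 0 at p = 1, so the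
   solution bounded there is unique up to a constant. Concretely: y = F(a,b;1;x)
   with a + b = 1 satisfies (x (1 - x) y')' = a b y, hence the Wronskian W of the
   two sides, weighted by the leading coefficient P of the self-adjoint form of
   their common equation, is constant; it vanishes at p = 1, where P does.
   So the ratio of the two sides is constant on (0, 1), and its value is read off
   at p = 1, where 1 - alpha = 1 - beta = 0. Squaring the ratio (and dropping
   sqrt (1 + 2 p) from W) keeps every coefficient rational in p. *)

Require Import Defs.
From Stdlib Require Import Reals Lra.
From Coquelicot Require Import Coquelicot.
Open Scope R_scope.

(** * Coefficients of the Gauss series *)

Lemma pochhammer_pos (a : R) (n : nat) : 0 < a -> 0 < pochhammer a n.
Proof.
intros Ha; induction n as [|n IH]; simpl.
- lra.
- apply Rmult_lt_0_compat; [exact IH | pose proof (pos_INR n); lra].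
Qed.

Lemma hyp2F1_coeff_pos (a b c : R) (n : nat) :
  0 < a -> 0 < b -> 0 < c -> 0 < hyp2F1_coeff a b c n.
Proof.
intros Ha Hb Hc; unfold hyp2F1_coeff.
apply Rdiv_lt_0_compat; apply Rmult_lt_0_compat;
  try (now apply pochhammer_pos); apply INR_fact_lt_0.
Qed.

Lemma hyp2F1_coeff_0 (a b c : R) : hyp2F1_coeff a b c 0 = 1.
Proof. unfold hyp2F1_coeff; simpl; field. Qed.

Lemma hyp2F1_coeff_S (a b c : R) (n : nat) :
  0 < c ->
  (c + INR n) * (INR n + 1) * hyp2F1_coeff a b c (S n) =
  (a + INR n) * (b + INR n) * hyp2F1_coeff a b c n.
Proof.
intros Hc; unfold hyp2F1_coeff.
rewrite fact_simpl, mult_INR, S_INR; simpl pochhammer.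
pose proof (pos_INR n); pose proof (INR_fact_neq_0 n).
pose proof (pochhammer_pos c n Hc).
field; repeat split; lra.
Qed.

Definition hyp2F1_derive (a b c x : R) : R :=
  PSeries (PS_derive (hyp2F1_coeff a b c)) x.

Lemma hyp2F1_0 (a b c : R) : hyp2F1 a b c 0 = 1.
Proof. unfold hyp2F1; rewrite PSeries_0; apply hyp2F1_coeff_0. Qed.

(** * The case a + b = 1, c = 1: convergence, differential equation, positivity *)

Section SymmetricHypergeometric.

Variables a b : R.
Hypotheses (Ha : 0 < a) (Hb : 0 < b) (Hab : a + b = 1).

Let u := hyp2F1_coeff a b 1.

(** As a + b = 1, (a + n)(b + n) = n(n + 1) + ab, the shape that yields a self-adjoint equation. *)
Lemma hyp2F1_coeff_sym_S (n : nat) :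
  (INR n + 1) * ((INR n + 1) * u (S n)) = (INR n * (INR n + 1) + a * b) * u n.
Proof.
generalize (hyp2F1_coeff_S a b 1 n Rlt_0_1); fold u.
replace b with (1 - a) by lra; intros H; nra.
Qed.

(** Since ab < 1, n(n + 1) + ab <= (n + 1)^2, so the coefficients do not increase from 1; hence a
    radius of at least 1. *)
Lemma hyp2F1_coeff_sym_le_1 (n : nat) : u n <= 1.
Proof.
induction n as [|n IH].
- unfold u; rewrite hyp2F1_coeff_0; lra.
- pose proof (hyp2F1_coeff_sym_S n) as HS.
  assert (Hu : 0 < u n) by (apply hyp2F1_coeff_pos; lra).
  pose proof (pos_INR n).
  assert (a * b < 1) by nra.
  apply Rmult_le_reg_l with ((INR n + 1) * (INR n + 1)); nra.
Qed.

Lemma hyp2F1_sym_inside (x : R) : Rabs x < 1 -> Rbar_lt (Rabs x) (CV_radius u).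
Proof.
intros Hx; apply Rbar_lt_le_trans with 1; [exact Hx |].
apply (proj1 (CV_radius_bounded u)).
exists 1; intros n.
assert (Hu : 0 < u n) by (apply hyp2F1_coeff_pos; lra).
rewrite pow1, Rmult_1_r, Rabs_pos_eq by lra.
apply hyp2F1_coeff_sym_le_1.
Qed.

Lemma is_derive_hyp2F1_sym (x : R) :
  Rabs x < 1 -> is_derive (hyp2F1 a b 1) x (hyp2F1_derive a b 1 x).
Proof. intros Hx; apply is_derive_PSeries, hyp2F1_sym_inside, Hx. Qed.

Lemma hyp2F1_sym_ode (x : R) :
  Rabs x < 1 ->
  is_derive (fun t => t * (1 - t) * hyp2F1_derive a b 1 t) x
    (a * b * hyp2F1 a b 1 x).
Proof.
intros Hx.
pose proof (hyp2F1_sym_inside x Hx) as Hr0.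
assert (Hr1 := Hr0); rewrite <- CV_radius_derive in Hr1.
assert (Hr2 := Hr1); rewrite <- CV_radius_derive in Hr2.
pose proof (is_derive_PSeries _ _ Hr1) as HD.
set (v := PS_derive u) in *; set (w := PS_derive v) in *.
(* The expanded equation with its negative terms moved across, so that both sides are sums of series
   and can be compared coefficientwise. *)
assert (Hode : PSeries v x + x * PSeries w x
  = a * b * PSeries u x + (2 * (x * PSeries v x) + x * (x * PSeries w x))).
{ assert (E0 : ex_pseries u x) by now apply CV_radius_inside.
  assert (E1 : ex_pseries v x) by now apply CV_radius_inside.
  assert (E2 : ex_pseries w x) by now apply CV_radius_inside.
  pose proof (ex_pseries_incr_1 v x E1) as I1.
  pose proof (ex_pseries_incr_1 w x E2) as I2.
  pose proof (ex_pseries_incr_1 _ x I2) as I3.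
  pose proof (ex_pseries_scal (a * b) u x (Rmult_comm _ _) E0) as S0.
  pose proof (ex_pseries_scal 2 _ x (Rmult_comm _ _) I1) as S1.
  rewrite <- !PSeries_incr_1, <- !PSeries_scal.
  rewrite <- (PSeries_plus _ _ x E1 I2), <- (PSeries_plus _ _ x S1 I3).
  rewrite <- (PSeries_plus _ _ x S0 (ex_pseries_plus _ _ x S1 I3)).
  apply PSeries_ext; intros n.
  pose proof (hyp2F1_coeff_sym_S n) as HS.
  unfold PS_plus, PS_scal, plus, scal; simpl; unfold mult; simpl.
  (* The double shift in x^2 y'' puts zeros at n = 0 and n = 1. *)
  destruct n as [|[|n]]; unfold w, v, PS_incr_1, PS_derive, zero; simpl PS_incr_1; simpl.
  - simpl in HS; lra.
  - simpl in HS; lra.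
  - rewrite !S_INR in *. simpl in *. destruct n; simpl in *; lra || nra. }
replace (a * b * hyp2F1 a b 1 x)
  with ((1 - 2 * x) * PSeries v x + x * (1 - x) * PSeries w x)
  by (unfold hyp2F1; fold u; lra).
unfold hyp2F1_derive; fold u; fold v.
auto_derive.
- eexists; exact HD.
- rewrite (is_derive_unique (fun t : R => PSeries v t) _ _ HD); ring.
Qed.

Lemma hyp2F1_sym_pos (x : R) : 0 <= x < 1 -> 0 < hyp2F1 a b 1 x.
Proof.
intros Hx.
assert (Hx' : Rabs x < 1) by (rewrite Rabs_pos_eq; lra).
pose proof (hyp2F1_sym_inside x Hx') as Hr.
apply CV_radius_inside in Hr.
apply ex_pseries_R in Hr.
unfold hyp2F1, PSeries; fold u.
rewrite Series_incr_1 by exact Hr.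
unfold u at 1; rewrite hyp2F1_coeff_0; simpl pow.
(* Writing the bound as a multiple by 0 avoids summing the zero series. *)
assert (Hs : 0 * Series (fun n : nat => 0) <= Series (fun n => u (S n) * x ^ S n)).
{ rewrite <- Series_scal_l; apply Series_le.
  - intros n; split; [lra |].
    rewrite Rmult_0_l; apply Rmult_le_pos; [| apply pow_le; lra].
    apply Rlt_le, hyp2F1_coeff_pos; lra.
  - now apply (ex_series_incr_1 (fun n => u n * x ^ n)). }
simpl in Hs |- *; lra.
Qed.

End SymmetricHypergeometric.

(** * The two functions along 1 - alpha and 1 - beta *)

Definition F2' := hyp2F1_derive (1 / 2) (1 / 2) 1.

Definition F3' := hyp2F1_derive (1 / 3) (2 / 3) 1.

Definition X (p : R) : R := 1 - p ^ 3 * (2 + p) / (1 + 2 * p).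

Definition Y (p : R) : R :=
  1 - 27 / 4 * (p ^ 2 * (1 + p) ^ 2 / (1 + p + p ^ 2) ^ 3).

(** The endpoint p = 1, where [X] vanishes, is included so that derivatives exist up to it. *)
Lemma X_bounds (p : R) : 0 < p <= 1 -> 0 <= X p < 1.
Proof.
intros Hp; unfold X; split.
- replace (1 - p ^ 3 * (2 + p) / (1 + 2 * p))
    with ((1 - p) * (1 + p) ^ 3 / (1 + 2 * p)) by (field; lra).
  apply Rdiv_le_0_compat; [| lra].
  apply Rmult_le_pos; [lra | apply pow_le; lra].
- assert (0 < p ^ 3 * (2 + p) / (1 + 2 * p)); [| lra].
  apply Rdiv_lt_0_compat; [| lra].
  apply Rmult_lt_0_compat; [apply pow_lt |]; lra.
Qed.

Lemma Y_bounds (p : R) : 0 < p <= 1 -> 0 <= Y p < 1.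
Proof.
intros Hp; unfold Y.
assert (Hm : 0 < 1 + p + p ^ 2) by nra.
split.
- replace (1 - 27 / 4 * (p ^ 2 * (1 + p) ^ 2 / (1 + p + p ^ 2) ^ 3))
    with (((1 - p) * (2 + p) * (1 + 2 * p)) ^ 2 / (4 * (1 + p + p ^ 2) ^ 3))
    by (field; lra).
  apply Rdiv_le_0_compat; [apply pow2_ge_0 |].
  apply Rmult_lt_0_compat; [lra | now apply pow_lt].
- assert (0 < p ^ 2 * (1 + p) ^ 2 / (1 + p + p ^ 2) ^ 3); [| lra].
  apply Rdiv_lt_0_compat; [| now apply pow_lt].
  apply Rmult_lt_0_compat; apply pow_lt; lra.
Qed.

Lemma is_derive_X (p : R) :
  0 < p -> is_derive X p (- 6 * p ^ 2 * (1 + p) ^ 2 / (1 + 2 * p) ^ 2).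
Proof. intros Hp; unfold X; auto_derive; [lra | field; lra]. Qed.

Lemma is_derive_Y (p : R) :
  0 < p ->
  is_derive Y p
    (- (27 / 4) * p * (1 + p) * (1 + 2 * p) * (1 - p) * (2 + p)
       / (1 + p + p ^ 2) ^ 4).
Proof.
intros Hp; assert (Hm : 0 < 1 + p + p ^ 2) by nra.
unfold Y; auto_derive.
- apply (pow_nonzero _ 3); lra.
- field; lra.
Qed.

Definition F2X (p : R) : R := F2 (X p).

Definition F3Y (p : R) : R := F3 (Y p).

(** The flux x (1 - x) y' of the self-adjoint equation: its derivative involves y only, so no second
    derivative of the series is ever needed. *)
Definition A2 (p : R) : R := X p * (1 - X p) * F2' (X p).

Definition A3 (p : R) : R := Y p * (1 - Y p) * F3' (Y p).

Lemma is_derive_F2X (p : R) :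
  0 < p <= 1 ->
  is_derive F2X p
    (- 6 * p ^ 2 * (1 + p) ^ 2 / (1 + 2 * p) ^ 2 * F2' (X p)).
Proof.
intros Hp; pose proof (X_bounds p Hp).
apply (is_derive_comp F2 X); [| apply is_derive_X; lra].
apply is_derive_hyp2F1_sym; try lra.
rewrite Rabs_pos_eq; lra.
Qed.

Lemma is_derive_F3Y (p : R) :
  0 < p <= 1 ->
  is_derive F3Y p
    (- (27 / 4) * p * (1 + p) * (1 + 2 * p) * (1 - p) * (2 + p)
       / (1 + p + p ^ 2) ^ 4 * F3' (Y p)).
Proof.
intros Hp; pose proof (Y_bounds p Hp).
apply (is_derive_comp F3 Y); [| apply is_derive_Y; lra].
apply is_derive_hyp2F1_sym; try lra.
rewrite Rabs_pos_eq; lra.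
Qed.

Lemma is_derive_A2 (p : R) :
  0 < p <= 1 ->
  is_derive A2 p
    (- 6 * p ^ 2 * (1 + p) ^ 2 / (1 + 2 * p) ^ 2 * (1 / 2 * (1 / 2) * F2X p)).
Proof.
intros Hp; pose proof (X_bounds p Hp).
apply (is_derive_comp (fun t => t * (1 - t) * F2' t) X); [| apply is_derive_X; lra].
apply hyp2F1_sym_ode; try lra.
rewrite Rabs_pos_eq; lra.
Qed.

Lemma is_derive_A3 (p : R) :
  0 < p <= 1 ->
  is_derive A3 p
    (- (27 / 4) * p * (1 + p) * (1 + 2 * p) * (1 - p) * (2 + p)
       / (1 + p + p ^ 2) ^ 4 * (1 / 3 * (2 / 3) * F3Y p)).
Proof.
intros Hp; pose proof (Y_bounds p Hp).
apply (is_derive_comp (fun t => t * (1 - t) * F3' t) Y); [| apply is_derive_Y; lra].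
apply hyp2F1_sym_ode; try lra.
rewrite Rabs_pos_eq; lra.
Qed.

(** * Vanishing of the Wronskian *)

(* P (U' V - U V') / sqrt (1 + 2 p) for U = (1 + p + p^2) F2(X),
   V = sqrt (1 + 2 p) F3(Y) and P = p (2 + p) (1 - p^2) / (2 (1 + p + p^2)^2),
   written through A2 and A3 so that no coefficient is singular at p = 1. *)
Definition wronskian (p : R) : R :=
  2 * (1 + p + p ^ 2) / (1 + 2 * p) * F2X p * A3 p
  - 3 / (1 + p + p ^ 2) * A2 p * F3Y p
  + 3 / 2 * p ^ 2 * (1 + p) ^ 2 * (2 + p) * (1 - p)
      / ((1 + 2 * p) * (1 + p + p ^ 2) ^ 2) * F2X p * F3Y p.

(** A constant divided by sqrt (1 + 2 p) has logarithmic derivative -1 / (1 + 2 p). *)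
Lemma is_derive_wronskian (p : R) :
  0 < p <= 1 -> is_derive wronskian p (- wronskian p / (1 + 2 * p)).
Proof.
intros Hp; assert (Hm : 0 < 1 + p + p ^ 2) by nra.
pose proof (is_derive_F2X p Hp) as H1.
pose proof (is_derive_F3Y p Hp) as H2.
pose proof (is_derive_A2 p Hp) as H3.
pose proof (is_derive_A3 p Hp) as H4.
unfold wronskian; auto_derive.
- repeat split; try (eexists; eassumption); try lra.
  apply Rgt_not_eq; repeat apply Rmult_lt_0_compat; lra.
- rewrite (is_derive_unique (fun q : R => F2X q) _ _ H1).
  rewrite (is_derive_unique (fun q : R => F3Y q) _ _ H2).
  rewrite (is_derive_unique (fun q : R => A2 q) _ _ H3).
  rewrite (is_derive_unique (fun q : R => A3 q) _ _ H4).
  unfold A2, A3.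
  (* With the four values as free variables, an identity of rational functions of p remains. *)
  generalize (F2X p) (F2' (X p)) (F3Y p) (F3' (Y p)); intros f f' g g'.
  unfold X, Y; field; lra.
Qed.

Lemma wronskian_0 (p : R) : 0 < p < 1 -> wronskian p = 0.
Proof.
intros Hp.
(* This product is the square of the constant P (U' V - U V'). *)
assert (Hc : (1 + 2 * p) * wronskian p ^ 2 = (1 + 2 * 1) * wronskian 1 ^ 2).
{ apply (eq_is_derive (fun q => (1 + 2 * q) * wronskian q ^ 2) p 1); [| lra].
  intros q Hq.
  assert (Hq' : 0 < q <= 1) by lra.
  pose proof (is_derive_wronskian q Hq') as HW.
  auto_derive; [eexists; exact HW |].
  rewrite (is_derive_unique (fun t : R => wronskian t) _ _ HW).
  unfold zero; simpl; field; lra. }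
assert (H1 : wronskian 1 = 0).
{ unfold wronskian, F2X, F3Y, A2, A3; replace (X 1) with 0 by (unfold X; field).
  replace (Y 1) with 0 by (unfold Y; field).
  field. }
rewrite H1 in Hc.
assert (wronskian p ^ 2 = 0) by nra; nra.
Qed.

(** * Constancy of (V / U)^2 and its value *)

Definition ratio_sq (p : R) : R :=
  (1 + 2 * p) * F3Y p ^ 2 / ((1 + p + p ^ 2) * F2X p) ^ 2.

Lemma F2X_pos (p : R) : 0 < p <= 1 -> 0 < F2X p.
Proof. intros Hp; apply hyp2F1_sym_pos; try lra; apply X_bounds, Hp. Qed.

Lemma F3Y_pos (p : R) : 0 < p <= 1 -> 0 < F3Y p.
Proof. intros Hp; apply hyp2F1_sym_pos; try lra; apply Y_bounds, Hp. Qed.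

Lemma is_derive_ratio_sq (p : R) :
  0 < p <= 1 ->
  is_derive ratio_sq p
    (2 * F3Y p / ((1 + p + p ^ 2) ^ 3 * F2X p ^ 3)
     * ((1 + p + p ^ 2) * F2X p
          * (F3Y p + (1 + 2 * p)
               * (- (27 / 4) * p * (1 + p) * (1 + 2 * p) * (1 - p) * (2 + p)
                    / (1 + p + p ^ 2) ^ 4 * F3' (Y p)))
        - (1 + 2 * p) * F3Y p
          * ((1 + 2 * p) * F2X p
             + (1 + p + p ^ 2)
               * (- 6 * p ^ 2 * (1 + p) ^ 2 / (1 + 2 * p) ^ 2 * F2' (X p))))).
Proof.
intros Hp; assert (Hm : 0 < 1 + p + p ^ 2) by nra.
pose proof (F2X_pos p Hp) as Hf.
pose proof (is_derive_F2X p Hp) as H1.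
pose proof (is_derive_F3Y p Hp) as H2.
unfold ratio_sq; auto_derive.
- repeat split; try (eexists; eassumption).
  apply Rgt_not_eq; repeat apply Rmult_lt_0_compat; lra.
- rewrite (is_derive_unique (fun q : R => F2X q) _ _ H1).
  rewrite (is_derive_unique (fun q : R => F3Y q) _ _ H2).
  field; lra.
Qed.

Lemma is_derive_ratio_sq_0 (p : R) : 0 < p < 1 -> is_derive ratio_sq p 0.
Proof.
intros Hp; assert (Hm : 0 < 1 + p + p ^ 2) by nra.
assert (Hp' : 0 < p <= 1) by lra.
pose proof (F2X_pos p Hp') as Hf.
pose proof (is_derive_ratio_sq p Hp') as H.
pose proof (wronskian_0 p Hp) as HW.
match type of H with is_derive _ _ ?d => replace 0 with d; [exact H |] end.
(* The derivative of (V / U)^2 is -2 V (U' V - U V') / U^3; dividing by P produces the factor 1 - p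
   below, hence p < 1. *)
transitivity (- 4 * F3Y p * (1 + 2 * p)
  / ((1 + p + p ^ 2) * F2X p ^ 3 * p * (1 + p) * (2 + p) * (1 - p)) * wronskian p);
  [| rewrite HW; ring].
unfold wronskian, A2, A3.
generalize (F2' (X p)) (F3Y p) (F3' (Y p)); intros f' g g'.
revert Hf; generalize (F2X p); intros f Hf.
unfold X, Y; field; lra.
Qed.

Lemma ratio_sq_const (p : R) : 0 < p < 1 -> ratio_sq p = 1 / 3.
Proof.
intros Hp.
transitivity (ratio_sq 1).
(* A zero derivative is needed only inside the interval; at p = 1 continuity suffices. *)
- destruct (MVT_gen ratio_sq p 1 (fun _ => 0)) as [c [_ Hc]]; [| | lra];
    rewrite Rmin_left, Rmax_right by lra; intros q Hq.
  + apply is_derive_ratio_sq_0; lra.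
  + apply continuity_pt_filterlim, (ex_derive_continuous ratio_sq).
    eexists; apply is_derive_ratio_sq; lra.
(* At p = 1 both series equal 1, leaving 3 / 3^2. *)
- unfold ratio_sq, F2X, F3Y; replace (X 1) with 0 by (unfold X; field).
  replace (Y 1) with 0 by (unfold Y; field).
  unfold F2, F3; rewrite !hyp2F1_0; field.
Qed.

Theorem theorem7 :
  forall p alpha beta : R,
    0 < p < 1 ->
    alpha = p ^ 3 * (2 + p) / (1 + 2 * p) ->
    beta = 27 / 4 * (p ^ 2 * (1 + p) ^ 2 / (1 + p + p ^ 2) ^ 3) ->
    (1 + p + p ^ 2) * F2 (1 - alpha) = sqrt (3 + 6 * p) * F3 (1 - beta).
Proof.
intros p alpha beta Hp -> ->; fold (X p) (Y p) (F2X p) (F3Y p).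
assert (Hm : 0 < 1 + p + p ^ 2) by nra.
assert (Hf : 0 < F2X p) by (apply F2X_pos; lra).
assert (Hg : 0 < F3Y p) by (apply F3Y_pos; lra).
pose proof (ratio_sq_const p Hp) as Hr; unfold ratio_sq in Hr.
assert (Hmf : 0 < (1 + p + p ^ 2) * F2X p) by now apply Rmult_lt_0_compat.
(* Both sides are nonnegative, so comparing squares suffices. *)
apply Rsqr_inj; [lra | apply Rmult_le_pos; [apply sqrt_pos | lra] |].
rewrite (Rsqr_mult (sqrt _)), (Rsqr_sqrt (3 + 6 * p)) by lra.
rewrite 2!Rsqr_pow2.
replace ((3 + 6 * p) * F3Y p ^ 2)
  with (3 * ((1 + 2 * p) * F3Y p ^ 2 / ((1 + p + p ^ 2) * F2X p) ^ 2)
        * ((1 + p + p ^ 2) * F2X p) ^ 2) by (field; lra).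
rewrite Hr; field.
Qed.
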